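(* Let $n\in\{0,1,2,\dots\}$. Then $\delta\mapsto ME_{n,\delta}$ is a log-convex function on $(0,n+1)$ (that is, $\ln ME_{n,\delta}$ is a convex function of $\delta\in(0,n+1)$), and $\delta\mapsto MG_{n,\delta}$ is a log-convex function on $(n,n+1)$ (that is, $\ln MG_{n,\delta}$ is a convex function of $\delta\in(n,n+1)$).
   Context: For $n\in\{0,1,2,\dots\}$ and $\delta\in(0,n+1)$, $$E_{n,\delta}(s)=\frac{1-\Bigl(1+\frac{s^1}{1!}+\dots+\frac{s^n}{n!}\Bigr)e^{-s}}{s^{\delta}}\quad(s>0),\qquad E_{n,\delta}(0)=0,$$ and $ME_{n,\delta}=\max_{s\ge 0}E_{n,\delta}(s)$ (the maximum is attained and positive). For $n\in\{0,1,2,\dots\}$ and $\delta\in(n,n+1)$, $$G_{n,\delta}(u)=(-1)^{n+1}\,\frac{e^{-u}-\Bigl(1-\frac{u^1}{1!}+\dots+(-1)^n\frac{u^n}{n!}\Bigr)}{u^{\delta}}\quad(u>0),\qquad G_{n,\delta}(0)=0,$$ and $MG_{n,\delta}=\max_{u\ge 0}G_{n,\delta}(u)$ (the maximum is attained and positive). *)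

(* Defs.v *)
From mathcomp Require Import all_boot all_order all_algebra.
From mathcomp Require Import all_classical all_reals all_analysis.

Set Implicit Arguments.
Unset Strict Implicit.
Unset Printing Implicit Defensive.

Import Order.TTheory GRing.Theory Num.Theory.

Local Open Scope classical_set_scope.
Local Open Scope ring_scope.

Definition fun_E (R : realType) (n : nat) (delta s : R) : R :=
  if 0 < s then
    (1 - (\sum_(k < n.+1) s ^+ k / k`!%:R) * expR (- s)) / s `^ delta
  else 0.

Definition fun_G (R : realType) (n : nat) (delta u : R) : R :=
  if 0 < u then
    (-1) ^+ n.+1 *
    (expR (- u) - \sum_(k < n.+1) (-1) ^+ k * (u ^+ k / k`!%:R)) / u `^ delta
  else 0.

(* The largest value attained by f on A; it is 0 when there is none, so that
   0 < max_on A f entails that the maximum is attained. *)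
Definition max_on (R : realType) (A : set R) (f : R -> R) : R :=
  xget 0 [set m | (f @` A) m /\ ubound (f @` A) m].

Definition ME (R : realType) (n : nat) (delta : R) : R :=
  max_on `[0, +oo[%classic (fun_E n delta).

Definition MG (R : realType) (n : nat) (delta : R) : R :=
  max_on `[0, +oo[%classic (fun_G n delta).

(* Positivity is part of the notion: the library's ln is 0 on nonpositive
   reals, so convexity of ln \o f alone would not be meaningful. *)
Definition log_convex (R : realType) (D : set R) (f : R -> R) : Prop :=
  (forall x : R, D x -> 0 < f x) /\
  convex_function (E := R^o) D (fun x => ln (f x)).

(* Main.v *)
Require Import Defs.
From mathcomp Require Import all_boot all_order all_algebra.
From mathcomp Require Import all_classical all_reals all_analysis.
From mathcomp Require Import ring lra.

Set Implicit Arguments.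
Unset Strict Implicit.
Unset Printing Implicit Defensive.

Import Order.TTheory GRing.Theory Num.Theory.
Import numFieldNormedType.Exports.

Local Open Scope classical_set_scope.
Local Open Scope convex_scope.
Local Open Scope ring_scope.

(** For a fixed [s > 0] and a numerator [h] with [h s > 0], the logarithm of
    [h s / s `^ delta] is [ln (h s) - delta * ln s], an affine function of
    [delta]. Hence [delta |-> ln (max_s h s / s `^ delta)] is a supremum of
    affine functions, and so it is convex; at a point [delta] it suffices to
    look at a maximizer [c] for that [delta], which gives an affine minorant of
    the whole function, touching it at [delta] ([log_convex_peak]).

    What remains is that the maximum is attained and positive. If
    [h s <= s ^+ a] and [h s <= s ^+ b] with [a < delta < b], then
    [h s / s `^ delta] tends to 0 both at 0 and at infinity, so a maximizer is
    found on a compact interval ([weighted_attained]). Both families have this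
    shape: the numerator of E lies in [(0, 1]] and below [s ^+ n.+1], and that
    of G, a Taylor remainder of [expR (- u)], lies below [u ^+ n] and
    [u ^+ n.+1]. *)

(** * Maxima of a numerator divided by a power *)

Lemma max_onE (R : realType) (A : set R) (f : R -> R) (c : R) :
  A c -> (forall x, A x -> f x <= f c) -> max_on A f = f c.
Proof.
move=> Ac maxc; apply: xget_unique.
  by split; [exists c | move=> _ [x Ax <-]; exact: maxc].
move=> m [[x Ax <-] ubm]; apply/eqP; rewrite eq_le maxc//=.
by apply: ubm; exists c.
Qed.

(** The common shape of [fun_E] and [fun_G]: both are convertible to
    [weighted h delta] for their numerator [h]. *)
Definition weighted (R : realType) (h : R -> R) (delta s : R) : R :=
  if 0 < s then h s / s `^ delta else 0.

Definition peak (R : realType) (h : R -> R) (delta : R) : R :=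
  max_on `[0, +oo[%classic (weighted h delta).

Lemma weighted_gt0E (R : realType) (h : R -> R) (delta s : R) :
  0 < s -> weighted h delta s = h s / s `^ delta.
Proof. by rewrite /weighted => ->. Qed.

Lemma weighted_gt0 (R : realType) (h : R -> R) (delta s : R) :
  0 < s -> 0 < h s -> 0 < weighted h delta s.
Proof. by move=> s0 hs; rewrite weighted_gt0E// divr_gt0// powR_gt0. Qed.

Lemma weighted_le_powR (R : realType) (h : R -> R) (delta s : R) (a : nat) :
  0 < s -> h s <= s ^+ a -> weighted h delta s <= s `^ (a%:R - delta).
Proof.
move=> s0 hs; rewrite weighted_gt0E// powRB; last first.
  by apply/implyP => _; rewrite gt_eqF.
by rewrite ler_pM2r ?invr_gt0 ?powR_gt0// powR_mulrn// ltW.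
Qed.

(** The value at 1 is [m = h 1], which lies in [(0, 1]]. Below [m `^ 1/(b-d)]
    the bound [s `^ (b-d)] is at most [m], and beyond [m `^ 1/(a-d)] the bound
    [s `^ (a-d)] is at most [m]; a maximizer over the compact interval between
    these two points, which contains 1, is therefore a global one. *)
Lemma weighted_attained (R : realType) (h : R -> R) (a b : nat) (delta : R) :
  {in `]0, +oo[, continuous h} ->
  (forall s, 0 < s -> 0 < h s) ->
  (forall s, 0 < s -> h s <= s ^+ a) ->
  (forall s, 0 < s -> h s <= s ^+ b) ->
  a%:R < delta < b%:R ->
  exists2 c, 0 < c & forall s, weighted h delta s <= weighted h delta c.
Proof.
move=> hcont h0 ha hb /andP[ad db].
have m0 : 0 < h 1 by exact: h0.
have m1 : h 1 <= 1 by rewrite (le_trans (ha _ _))// expr1n.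
have bd0 : 0 < b%:R - delta by rewrite subr_gt0.
have ad0 : a%:R - delta < 0 by rewrite subr_lt0.
pose lo := h 1 `^ (b%:R - delta)^-1.
pose hi := h 1 `^ (a%:R - delta)^-1.
have lo0 : 0 < lo by exact: powR_gt0.
have hi0 : 0 < hi by exact: powR_gt0.
have lo1 : lo <= 1.
  by rewrite -(powRr0 (h 1)); apply: ger_powR; rewrite ?m0// invr_ge0 ltW.
have hi1 : 1 <= hi.
  by rewrite -(powRr0 (h 1)); apply: ger_powR; rewrite ?m0// invr_le0 ltW.
have w1 : weighted h delta 1 = h 1 by rewrite weighted_gt0E// powR1 divr1.
have left_small s : 0 < s -> s <= lo -> weighted h delta s <= h 1.
  move=> s0 slo; apply: (le_trans (weighted_le_powR delta s0 (hb _ s0))).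
  have -> : h 1 = lo `^ (b%:R - delta).
    by rewrite /lo -powRrM mulVf ?gt_eqF// powRr1// ltW.
  by apply: ge0_ler_powR; rewrite ?nnegrE// ltW.
have right_small s : 0 < s -> hi <= s -> weighted h delta s <= h 1.
  move=> s0 his; apply: (le_trans (weighted_le_powR delta s0 (ha _ s0))).
  have -> : h 1 = hi `^ (a%:R - delta).
    by rewrite /hi -powRrM mulVf ?lt_eqF// powRr1// ltW.
  rewrite -[a%:R - delta]opprK !(powRN _ (- _)) lef_pV2 ?posrE ?powR_gt0//.
  by apply: ge0_ler_powR; rewrite ?nnegrE ?oppr_ge0// ltW.
have cont : {within `[lo, hi], continuous (fun s => h s / s `^ delta)}.
  apply: continuous_in_subspaceT => s; rewrite inE/= in_itv/= => /andP[los _].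
  have s0 : s \in `]0, +oo[ by rewrite in_itv/= andbT (lt_le_trans lo0).
  apply: cvgM; first exact: hcont.
  apply: cvgV; first by rewrite gt_eqF// powR_gt0// (lt_le_trans lo0).
  have : {for s, continuous (@powR R ^~ delta)} by
    exact/differentiable_continuous/derivable1_diffP/derivable_powR.
  exact.
have [c] := EVT_max (le_trans lo1 hi1) cont.
rewrite in_itv/= => /andP[loc _] maxc.
have c0 : 0 < c := lt_le_trans lo0 loc.
have mid s : lo <= s -> s <= hi -> weighted h delta s <= weighted h delta c.
  move=> los shi; rewrite !weighted_gt0E ?(lt_le_trans lo0 los)//.
  by apply: maxc; rewrite in_itv/= los.
have m_le : h 1 <= weighted h delta c by rewrite -w1; exact: mid.
exists c => // s; have [s0|s0] := ltP 0 s; last first.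
  rewrite {1}/weighted ltNge s0/= ltW//; exact: weighted_gt0 (h0 _ c0).
have [slo|/ltW los] := leP s lo; first exact: le_trans (left_small _ s0 slo) _.
have [his|/ltW shi] := leP hi s; first exact: le_trans (right_small _ s0 his) _.
exact: mid.
Qed.

(** With [c] a maximizer for [x <| t |> y], the logarithm of the peak there is
    affine in the exponent, and each of its two terms is bounded by the peak at
    [x] and at [y]. *)
Lemma log_convex_peak (R : realType) (h : R -> R) (a b : nat) :
  {in `]0, +oo[, continuous h} ->
  (forall s, 0 < s -> 0 < h s) ->
  (forall s, 0 < s -> h s <= s ^+ a) ->
  (forall s, 0 < s -> h s <= s ^+ b) ->
  log_convex `]a%:R, b%:R[%classic (peak h).
Proof.
move=> hcont h0 ha hb.
have peakP d : `]a%:R, b%:R[%classic d -> exists c, [/\ 0 < c,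
    peak h d = weighted h d c & forall s, weighted h d s <= peak h d].
  move=> /=; rewrite in_itv/= => dab.
  have [c c0 maxc] := weighted_attained hcont h0 ha hb dab.
  have peakE : peak h d = weighted h d c.
    by apply: max_onE => //; rewrite /= in_itv/= andbT ltW.
  by exists c; split=> // s; rewrite peakE.
have ln_weighted d c : 0 < c -> ln (weighted h d c) = ln (h c) - d * ln c.
  move=> c0; rewrite weighted_gt0E// ln_div ?posrE ?powR_gt0 ?h0//.
  by rewrite ln_powR.
have peak_gt0 d : `]a%:R, b%:R[%classic d -> 0 < peak h d.
  by move=> /peakP[c [c0 -> _]]; rewrite weighted_gt0// h0.
split=> [//|t x y]; rewrite !inE => xab yab.
(* The arguments and the values are combined in two different convex-space
   structures on R, hence one expansion for each. *)
have convE : x <| t |> y = t%:num * x + (1 - t%:num) * y :> R by [].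
have conv_valE (p q : R^o) : p <| t |> q = t%:num * p + (1 - t%:num) * q :> R.
  by rewrite convRE.
have t0 : 0 <= t%:num by [].
have t1 : 0 <= 1 - t%:num by rewrite subr_ge0.
have conv_ab : `]a%:R, b%:R[%classic (x <| t |> y : R).
  move: xab yab; rewrite /= convE !in_itv/= => /andP[ax xb] /andP[ay yb].
  by have [xy|yx] := leP x y; apply/andP; split; nra.
have [c [c0 peakE _]] := peakP _ conv_ab.
have line_le d : `]a%:R, b%:R[%classic d ->
    ln (h c) - d * ln c <= ln (peak h d).
  move=> dab; have [_ [_ _ le_peak]] := peakP _ dab.
  by rewrite -ln_weighted// ler_ln ?posrE ?peak_gt0// weighted_gt0// h0.
rewrite [X in X <= _](_ : _ =
    (ln (h c) - x * ln c : R^o) <| t |> (ln (h c) - y * ln c)).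
  by rewrite !conv_valE; apply: lerD; apply: ler_wpM2l => //; exact: line_le.
by rewrite peakE ln_weighted// convE conv_valE; ring.
Qed.

(** * The numerators of E and G *)

Lemma continuous_from_derive (R : realType) (f df : R -> R) :
  (forall x : R, is_derive x 1 f (df x)) -> continuous f.
Proof.
move=> fdf x; apply: differentiable_continuous.
by apply/derivable1_diffP; apply: (@ex_derive _ _ _ _ _ _ _ (fdf x)).
Qed.

Lemma gt0_from_derive (R : realType) (f df : R -> R) :
  f 0 = 0 -> (forall x : R, is_derive x 1 f (df x)) ->
  (forall x, 0 < x -> 0 < df x) -> forall x, 0 < x -> 0 < f x.
Proof.
move=> f0 fdf df0 x x0.
have fcont := continuous_subspaceT (continuous_from_derive fdf).
have [c] := MVT x0 (fun z _ => fdf z) (fcont _).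
rewrite in_itv/= f0 !subr0 => /andP[c0 _] ->.
by rewrite mulr_gt0// df0.
Qed.

Definition monomial (R : realType) (n : nat) (s : R) : R := s ^+ n / n`!%:R.

Definition numE (R : realType) (n : nat) (s : R) : R :=
  1 - (\sum_(k < n.+1) s ^+ k / k`!%:R) * expR (- s).

Definition numG (R : realType) (n : nat) (u : R) : R :=
  (-1) ^+ n.+1 *
  (expR (- u) - \sum_(k < n.+1) (-1) ^+ k * (u ^+ k / k`!%:R)).

Section numerators.
Variable R : realType.
Implicit Types (s u : R) (n : nat).

Lemma monomial0 s : monomial 0 s = 1.
Proof. by rewrite /monomial expr0 fact0 divr1. Qed.

Lemma monomialS_at0 n : monomial n.+1 (0 : R) = 0.
Proof. by rewrite /monomial expr0n mul0r. Qed.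

Lemma monomial_gt0 n s : 0 < s -> 0 < monomial n s.
Proof. by move=> s0; rewrite divr_gt0 ?exprn_gt0// ltr0n fact_gt0. Qed.

Lemma monomial_le n s : 0 < s -> monomial n s <= s ^+ n.
Proof.
move=> s0; rewrite ler_pdivrMr ?ltr0n ?fact_gt0//.
by apply: ler_peMr; rewrite ?ler1n ?fact_gt0 ?exprn_ge0 1?ltW.
Qed.

Lemma is_derive_monomial n s : is_derive s 1 (@monomial R n.+1) (monomial n s).
Proof.
have -> : @monomial R n.+1 = (n.+1`!%:R)^-1 \*: ((@id R) ^+ n.+1).
  by apply/funext => x; rewrite /monomial/= !fctE mulrC.
apply: is_derive_eq; rewrite /monomial /= /GRing.scale/= mulr1.
have n1_neq0 : n.+1%:R != 0 :> R by rewrite pnatr_eq0.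
by rewrite factS natrM invfM mulrACA mulVf// mul1r mulrC.
Qed.

Lemma is_derive_expRN s : is_derive s 1 (fun x => expR (- x) : R) (- expR (- s)).
Proof.
have -> : (fun x : R => expR (- x)) = expR \o -%R by [].
by apply: is_derive_eq; rewrite /GRing.scale/= ?mulN1r ?mulrN1.
Qed.

Lemma numE0 s : numE 0 s = 1 - expR (- s).
Proof. by rewrite /numE big_ord1 -/(monomial 0 s) monomial0 mul1r. Qed.

Lemma numES n s : numE n.+1 s = numE n s - monomial n.+1 s * expR (- s).
Proof. by rewrite /numE big_ord_recr/= -/(monomial n.+1 s); ring. Qed.

Lemma numE_at0 n : numE n (0 : R) = 0.
Proof.
elim: n => [|n IHn]; first by rewrite numE0 oppr0 expR0 subrr.
by rewrite numES IHn monomialS_at0 mul0r subrr.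
Qed.

(** Differentiating the product, the contributions of consecutive terms of the
    sum cancel and only the one of the last term is left. *)
Lemma is_derive_numE n s :
  is_derive s 1 (@numE R n) (monomial n s * expR (- s)).
Proof.
have dexp := is_derive_expRN.
elim: n s => [|n IHn] s.
  have -> : @numE R 0 = cst 1 - (fun x : R => expR (- x)).
    by apply/funext => x; rewrite numE0.
  by apply: is_derive_eq; rewrite monomial0; ring.
have -> : @numE R n.+1 = numE n - @monomial R n.+1 * (fun x : R => expR (- x)).
  by apply/funext => x; rewrite numES.
have dmon := is_derive_monomial n.
by apply: is_derive_eq; rewrite /GRing.scale/=; ring.
Qed.

Lemma numE_gt0 n s : 0 < s -> 0 < numE n s.
Proof.
apply: (gt0_from_derive (numE_at0 n) (is_derive_numE n)) => x x0.
by rewrite mulr_gt0 ?monomial_gt0 ?expR_gt0.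
Qed.

Lemma numE_le1 n s : 0 < s -> numE n s <= s ^+ 0.
Proof.
move=> s0; rewrite expr0 /numE gerBl mulr_ge0 ?expR_ge0// sumr_ge0// => k _.
exact/ltW/monomial_gt0.
Qed.

(** The derivative of [numE n] is that of [monomial n.+1] damped by
    the factor [expR (- s)], which is below 1 for [s > 0]. *)
Lemma numE_leX n s : 0 < s -> numE n s <= s ^+ n.+1.
Proof.
move=> s0; apply: le_trans (monomial_le n.+1 s0); rewrite -subr_ge0; apply: ltW.
pose f := @monomial R n.+1 - numE n.
apply: (@gt0_from_derive _ f (fun x => monomial n x * (1 - expR (- x)))) => //.
- by rewrite -[LHS]/(monomial n.+1 0 - numE n 0) numE_at0 monomialS_at0 subrr.
- move=> x; have dmon := is_derive_monomial n; have dnum := is_derive_numE n.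
  by apply: is_derive_eq; ring.
- by move=> x x0; rewrite mulr_gt0 ?monomial_gt0// subr_gt0 expR_lt1 oppr_lt0.
Qed.

Lemma numG0 u : numG 0 u = 1 - expR (- u).
Proof.
by rewrite /numG big_ord1 -/(monomial 0 u) monomial0 expr0 expr1; ring.
Qed.

Lemma numGS n u : numG n.+1 u = monomial n.+1 u - numG n u.
Proof.
rewrite /numG big_ord_recr/= -/(monomial n.+1 u) [(-1) ^+ n.+2]exprS.
have := sqrr_sign R n.+1; move: ((-1) ^+ n.+1) => w; rewrite expr2 => ww1.
by ring: ww1.
Qed.

Lemma numG_at0 n : numG n (0 : R) = 0.
Proof.
elim: n => [|n IHn]; first by rewrite numG0 oppr0 expR0 subrr.
by rewrite numGS IHn monomialS_at0 subrr.
Qed.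

(** By [numGS] the derivative of [numG n.+1] is [numG n]; the form below also
    covers the first index. *)
Lemma is_derive_numG n u : is_derive u 1 (@numG R n) (monomial n u - numG n u).
Proof.
elim: n u => [|n IHn] u.
  have -> : @numG R 0 = cst 1 - (fun x : R => expR (- x)).
    by apply/funext => x; rewrite numG0.
  have dexp := is_derive_expRN.
  by apply: is_derive_eq; rewrite monomial0 !fctE; ring.
have -> : @numG R n.+1 = @monomial R n.+1 - numG n.
  by apply/funext => x; rewrite numGS.
have dmon := is_derive_monomial n.
by apply: is_derive_eq; rewrite !fctE; ring.
Qed.

Lemma numG_gt0 n u : 0 < u -> 0 < numG n u.
Proof.
elim: n u => [|n IHn] u.
  by move=> u0; rewrite numG0 subr_gt0 expR_lt1 oppr_lt0.
apply: (gt0_from_derive (numG_at0 n.+1) (is_derive_numG n.+1)) => x x0.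
by rewrite numGS subKr IHn.
Qed.

(** Consecutive numerators are positive and add up to a monomial, so each is
    below that monomial; the previous and the next numerator give the two
    bounds, with [expR (- u)] in the role of the one before [numG 0]. *)
Lemma numG_leX n u : 0 < u -> numG n u <= u ^+ n.
Proof.
move=> u0; apply: le_trans (monomial_le n u0).
case: n => [|n]; first by rewrite numG0 monomial0 gerBl expR_ge0.
by rewrite numGS gerBl ltW// numG_gt0.
Qed.

Lemma numG_leXS n u : 0 < u -> numG n u <= u ^+ n.+1.
Proof.
move=> u0; apply: le_trans (monomial_le n.+1 u0).
by rewrite -subr_ge0 -numGS ltW// numG_gt0.
Qed.

End numerators.

Theorem mainTheorem15 (R : realType) (n : nat) :
  log_convex `]0, n.+1%:R[%classic (fun delta : R => ME n delta) /\
  log_convex `]n%:R, n.+1%:R[%classic (fun delta : R => MG n delta).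
Proof.
split.
- apply: (@log_convex_peak R (numE n) 0 n.+1).
  + by move=> x _; exact: (continuous_from_derive (@is_derive_numE R n)).
  + exact: numE_gt0.
  + exact: numE_le1.
  + exact: numE_leX.
- apply: (@log_convex_peak R (numG n) n n.+1).
  + by move=> x _; exact: (continuous_from_derive (@is_derive_numG R n)).
  + exact: numG_gt0.
  + exact: numG_leX.
  + exact: numG_leXS.
Qed.
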